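(* Let $(M,g)$ be a semi-Riemannian manifold of dimension $n\ge 3$, with curvature tensor $R$, Ricci tensor $S$ and projective curvature tensor $P$. Then $$(R\cdot P)(X_1,X_2,X_3,X_4,X_5,X_6)+(R\cdot P)(X_3,X_4,X_5,X_6,X_1,X_2)+(R\cdot P)(X_5,X_6,X_1,X_2,X_3,X_4)=0$$ holds for all vector fields $X_1,\dots,X_6$ on $M$ if and only if $M$ is Ricci semisymmetric, i.e. $R\cdot S=0$.
   Context: $(M,g)$ is a connected smooth semi-Riemannian manifold of dimension $n\ge 3$; $R$ is the $(0,4)$ Riemann curvature tensor, with the sign convention that the Ricci tensor $S(X_2,X_3)$ is the $g$-trace of $R(X_1,X_2,X_3,X_4)$ over $X_1,X_4$. The projective curvature tensor is $P(X_1,X_2,X_3,X_4)=R(X_1,X_2,X_3,X_4)-\frac{1}{n-1}\left[S(X_2,X_3)g(X_1,X_4)-S(X_1,X_3)g(X_2,X_4)\right]$. For a $(0,4)$-tensor $D$, let $\mathcal D$ be the $(1,3)$-tensor with $g(\mathcal D(X,Y)X_1,X_2)=D(X,Y,X_1,X_2)$. For a $(0,k)$-tensor $H$, the $(0,k+2)$-tensor $D\cdot H$ is $$(D\cdot H)(X_1,\dots,X_k,X,Y)=-H(\mathcal D(X,Y)X_1,X_2,\dots,X_k)-\cdots-H(X_1,\dots,X_{k-1},\mathcal D(X,Y)X_k).$$ *)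

(* Defs.v *)
From HB Require Import structures.
From mathcomp Require Export all_boot all_order all_algebra.
From mathcomp Require Export all_classical all_reals all_analysis.

Set Implicit Arguments.
Unset Strict Implicit.
Unset Printing Implicit Defensive.

Import Order.TTheory GRing.Theory Num.Theory.
Export numFieldNormedType.Exports.

Local Open Scope classical_set_scope.
Local Open Scope ring_scope.

Section Smooth.
Variables (R : realType) (n : nat).

Definition partial (i : 'I_n) (f : 'rV[R]_n -> R) : 'rV[R]_n -> R :=
  'D_(delta_mx 0 i) f.

Definition iter_partial (s : seq 'I_n) (f : 'rV[R]_n -> R) : 'rV[R]_n -> R :=
  foldr partial f s.

(* C^infinity on U; only meaningful for open U, as [differentiable] and
   [partial] look at a full neighbourhood of x. *)
Definition smooth_on (U : set 'rV[R]_n) (f : 'rV[R]_n -> R) :=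
  forall s x, U x -> differentiable (iter_partial s f) x.

End Smooth.

(* A smooth manifold of dimension n, presented by an atlas of charts
   [phi i : dom i -> 'rV_n] with inverses [psi i].  The values of [phi i]
   outside [dom i] and of [psi i] outside [phi i @` dom i] are irrelevant. *)
Record manifold (R : realType) (n : nat) := Manifold {
  carrier :> topologicalType ;
  mfd_hausdorff : hausdorff_space carrier ;
  mfd_second_countable : @second_countable carrier ;
  chart : Type ;
  dom : chart -> set carrier ;
  phi : chart -> carrier -> 'rV[R]_n ;
  psi : chart -> 'rV[R]_n -> carrier ;
  dom_cover : forall p, exists i, dom i p ;
  dom_open : forall i, open (dom i) ;
  phi_open : forall i, open (phi i @` dom i) ;
  phiK : forall i p, dom i p -> psi i (phi i p) = p ;
  phi_continuous : forall i, {within dom i, continuous (phi i)} ;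
  psi_continuous : forall i, {within phi i @` dom i, continuous (psi i)} ;
  transition_smooth : forall i j k,
    smooth_on (phi i @` (dom i `&` dom j)) (fun x => phi j (psi i x) 0 k)
}.

Section Geometry.
Variables (R : realType) (n : nat) (M : manifold R n).

(* The library's Jacobian acts on row vectors from the right: the components
   of a tangent vector at p change by [v |-> v *m transition_jacobian i j p]
   from chart i to chart j. *)
Definition transition_jacobian (i j : chart M) (p : M) : 'M[R]_n :=
  jacobian (phi j \o psi i) (phi i p).

(* A smooth vector field, given by its components in every chart. *)
Record vector_field := VectorField {
  vf_comp :> chart M -> M -> 'rV[R]_n ;
  vf_change : forall i j p, dom i p -> dom j p ->
    vf_comp j p = vf_comp i p *m transition_jacobian i j p ;
  vf_smooth : forall i k,
    smooth_on (phi i @` dom i) (fun x => vf_comp i (psi i x) 0 k)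
}.

(* A semi-Riemannian metric, given by its Gram matrix in every chart.  No
   condition on the signature is needed: by continuity the index of a
   nondegenerate metric is constant on a connected manifold. *)
Record semi_riemannian_metric := SemiRiemannianMetric {
  gram :> chart M -> M -> 'M[R]_n ;
  gram_sym : forall i p, dom i p -> (gram i p)^T = gram i p ;
  gram_nondegenerate : forall i p, dom i p -> gram i p \in unitmx ;
  gram_change : forall i j p, dom i p -> dom j p ->
    gram i p =
    transition_jacobian i j p *m gram j p *m (transition_jacobian i j p)^T ;
  gram_smooth : forall i a b,
    smooth_on (phi i @` dom i) (fun x => gram i (psi i x) a b)
}.

End Geometry.

Section Algebra.
Variables (R : realType) (n : nat).
Local Notation V := 'rV[R]_n.

Definition tensor k := k.-tuple V -> R.

Variable G : 'M[R]_n.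

Definition inner (v w : V) : R := (v *m G *m w^T) 0 0.

Definition ricci (D : tensor 4) : tensor 2 := fun X =>
  \sum_(a < n) \sum_(b < n) invmx G a b *
    D [tuple delta_mx 0 a; tnth X 0; tnth X 1; delta_mx 0 b].

Definition projective (D : tensor 4) : tensor 4 := fun X =>
  let X1 := tnth X 0 in let X2 := tnth X 1 in
  let X3 := tnth X 2 in let X4 := tnth X 3 in
  D X - (n%:R - 1)^-1 *
    (ricci D [tuple X2; X3] * inner X1 X4 -
     ricci D [tuple X1; X3] * inner X2 X4).

(* The vector W such that [inner W U = D [tuple X; Y; Z; U]] for all U. *)
Definition raise (D : tensor 4) (X Y Z : V) : V :=
  (\row_b D [tuple X; Y; Z; delta_mx 0 b]) *m invmx G.

(* The tensor [D . H]; the last two arguments are those written X, Y in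
   (D . H)(X_1, ..., X_k, X, Y). *)
Definition tensor_dot (D : tensor 4) k (H : tensor k)
    (X : k.-tuple V) (Y Z : V) : R :=
  - \sum_(a < k)
      H [tuple if b == a then raise D Y Z (tnth X b) else tnth X b | b < k].

End Algebra.

Section Curvature.
Variables (R : realType) (n : nat) (M : manifold R n).
Variable g : semi_riemannian_metric M.
Variable i : chart M.

Definition christoffel (l a b : 'I_n) (x : 'rV[R]_n) : R :=
  let gx c d := fun y => g i (psi i y) c d in
  2^-1 * \sum_(m < n) invmx (g i (psi i x)) l m *
    (partial a (gx m b) x + partial b (gx m a) x - partial m (gx a b) x).

(* The l-th component of R(e_a, e_b)e_c, where
   R(X, Y)Z = nabla_X nabla_Y Z - nabla_Y nabla_X Z - nabla_[X, Y] Z. *)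
Definition riemann_comp (l a b c : 'I_n) (x : 'rV[R]_n) : R :=
  partial a (christoffel l b c) x - partial b (christoffel l a c) x
  + \sum_(m < n) (christoffel l a m x * christoffel m b c x
                  - christoffel l b m x * christoffel m a c x).

(* Tensor fields are evaluated at p through components in the chart i, which is
   legitimate when [dom i p]; statements quantify over all such charts. *)
Variable p : M.

(* R(X1, X2, X3, X4) = g(R(X1, X2)X3, X4) *)
Definition riemann : tensor R n 4 := fun X =>
  \sum_(a < n) \sum_(b < n) \sum_(c < n)
    tnth X 0 0 a * tnth X 1 0 b * tnth X 2 0 c *
    inner (g i p) (\row_l riemann_comp l a b c (phi i p)) (tnth X 3).

Definition R_dot_P (X1 X2 X3 X4 X5 X6 : vector_field M) : R :=
  tensor_dot (g i p) riemann (projective (g i p) riemann)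
    [tuple X1 i p; X2 i p; X3 i p; X4 i p] (X5 i p) (X6 i p).

Definition R_dot_S (X1 X2 X Y : vector_field M) : R :=
  tensor_dot (g i p) riemann (ricci (g i p) riemann)
    [tuple X1 i p; X2 i p] (X i p) (Y i p).

End Curvature.

Definition ricci_semisymmetric (R : realType) (n : nat) (M : manifold R n)
    (g : semi_riemannian_metric M) :=
  forall (X1 X2 X Y : vector_field M) (i : chart M) (p : M),
    dom i p -> R_dot_S g i p X1 X2 X Y = 0.

(* Main.v *)
Require Import Defs.
From mathcomp Require Import ring lra.

(* Pointwise, the cyclic sum of R.R vanishes: with
   K(12|34|56) = g([R(X3,X4), R(X5,X6)] X1, X2) one has
   (R.R)(X1,...,X6) = - K(12|34|56) - K(34|12|56), and K is skew in its last two
   pairs.  As R.g = 0, the cyclic condition on R.P therefore says, with T = R.S,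
   that the cyclic sum of
   g(X1,X4) T(X2,X3;X5,X6) - g(X2,X4) T(X1,X3;X5,X6) is zero.
   Contracting over X1, X4 and then once more shows that
   A(b,c) = tr T(., b; ., c) satisfies (n-1) A(b,c) = n A(c,b), so A = 0; what
   remains is (n-1) T(a,b;c,d) = T(b,c;d,a), which forces T = 0.
   Passing from vector fields to tangent vectors uses bump functions; the
   symmetries of R are read off its expression by second derivatives of g. *)

Set Implicit Arguments.
Unset Strict Implicit.
Unset Printing Implicit Defensive.

Import Order.TTheory GRing.Theory Num.Theory.

Local Open Scope classical_set_scope.
Local Open Scope ring_scope.

(** * Functions of class C^k *)

(** The first-order expansion of [f] at [x] is also one of [h], and uniqueness of the differential
    identifies ['d h x] with ['d f x]. *)
Lemma near_eq_differentiable (K : numFieldType) (V W : normedModType K)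
    (f h : V -> W) (x : V) :
  (\near x, f x = h x) -> differentiable f x -> differentiable h x.
Proof.
move=> fh df; have fhx : f x = h x := nbhs_singleton fh.
have Hh : h \o shift x = cst (h x) + 'd f x +o_ 0 id.
  apply/eqaddoP => e e0.
  have /eqaddoP /(_ e e0) := diff_locally df.
  have : \forall y \near 0, f (y + x) = h (y + x).
    by move: fh; rewrite (near_shift 0 x) /= subr0.
  by apply: filterS2 => y fhy; rewrite -fhx; rewrite !fctE /= fhy.
apply/diff_locallyP; rewrite (diff_unique (diff_continuous df) Hh).
by split => //; exact: diff_continuous.
Qed.

Section Smooth.
Context {R : realType} {n : nat}.
Implicit Types (U : set 'rV[R]_n) (f h : 'rV[R]_n -> R) (x : 'rV[R]_n).

Lemma open_nearP U f h x : open U -> {in U, f =1 h} -> U x ->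
  \forall y \near x, f y = h y.
Proof.
move=> oU fh Ux.
by apply: filterS (open_nbhs_nbhs (conj oU Ux)) => y Uy; apply: fh; rewrite inE.
Qed.

(* All iterated partials of order at most k are differentiable, so [Ck 0] is
   stronger than continuity. *)
Fixpoint Ck k U f : Prop :=
  (forall x, U x -> differentiable f x) /\
  (if k is k'.+1 then forall i, Ck k' U (partial i f) else True).

Lemma Ck_differentiable k U f x : Ck k U f -> U x -> differentiable f x.
Proof. by case: k => [|k] [] + _ => /[apply]. Qed.

Lemma CkS k U f : Ck k.+1 U f -> Ck k U f.
Proof.
elim: k f => [|k IH] f [df pf]; split => //.
by move=> i; apply: IH; apply: pf.
Qed.

(** [Ck] peels off the derivative that is applied first, which [foldr] keeps at the end of the list;
    hence [rcons] and the induction from the right. *)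
Lemma smooth_onP U f : smooth_on U f <-> forall k, Ck k U f.
Proof.
split=> [sf k|Cf s x Ux].
  elim: k f sf => [|k IH] f sf; split => //; try exact: (sf [::]).
  by move=> i; apply: IH => s x /(sf (rcons s i));
    rewrite /iter_partial foldr_rcons.
elim/last_ind: s f Cf => [|s i IH] f Cf;
  first exact: Ck_differentiable (Cf 0) Ux.
rewrite /iter_partial foldr_rcons; apply: IH => k.
exact: (Cf k.+1).2.
Qed.

(** On an open [U], agreement on [U] is agreement near each of its points, so all partial
    derivatives agree as well. *)
Lemma eq_Ck k U f h : open U -> {in U, f =1 h} -> Ck k U f -> Ck k U h.
Proof.
move=> oU; elim: k f h => [|k IH] f h fh [df pf].
  by split => // x Ux; apply: near_eq_differentiable (df x Ux);
    apply: open_nearP Ux.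
split=> [x Ux|i].
  by apply: near_eq_differentiable (df x Ux); apply: open_nearP Ux.
apply: IH (pf i) => x; rewrite inE => Ux.
by apply: near_eq_derive; apply: open_nearP Ux.
Qed.


Lemma Ck_cst k U (c : R) : open U -> Ck k U (fun=> c).
Proof.
move=> oU; elim: k c => [|k IH] c; split => //;
  try by move=> x _; exact: differentiable_cst.
move=> i; apply: (@eq_Ck _ _ (fun=> 0)) => //.
by move=> x _; rewrite /partial derive_cst.
Qed.

Lemma CkD k U f h : open U -> Ck k U f -> Ck k U h ->
  Ck k U (fun x => f x + h x).
Proof.
move=> oU; elim: k f h => [|k IH] f h [df pf] [dh ph].
  by split => // x Ux; apply: differentiableD; [exact: df|exact: dh].
split=> [x Ux|i]; first by apply: differentiableD; [exact: df|exact: dh].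
apply: eq_Ck (IH _ _ (pf i) (ph i)) => // x /set_mem Ux.
by rewrite /partial deriveD//; apply: diff_derivable; [exact: df|exact: dh].
Qed.

Lemma CkM k U f h : open U -> Ck k U f -> Ck k U h ->
  Ck k U (fun x => f x * h x).
Proof.
move=> oU; elim: k f h => [|k IH] f h Cf Ch;
have [df pf] := Cf; have [dh ph] := Ch.
  by split => // x Ux; apply: differentiableM; [exact: df|exact: dh].
split=> [x Ux|i]; first by apply: differentiableM; [exact: df|exact: dh].
(* In Leibniz's rule each term keeps one factor undifferentiated; [CkS] lowers its order to match
   the other factor. *)
have C1 := IH _ _ (CkS Cf) (ph i); have C2 := IH _ _ (CkS Ch) (pf i).
apply: eq_Ck (CkD oU C1 C2) => // x /set_mem Ux.
by rewrite /partial deriveM//; apply: diff_derivable; [exact: df|exact: dh].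
Qed.

Lemma Ck_sum k U (I : Type) (r : seq I) (P : pred I) (F : I -> 'rV[R]_n -> R) :
  open U -> (forall i, P i -> Ck k U (F i)) ->
  Ck k U (fun x => \sum_(i <- r | P i) F i x).
Proof.
move=> oU CF; elim: r => [|i r IH].
  by apply: eq_Ck (Ck_cst k 0 oU) => // x _; rewrite big_nil.
case Pi: (P i); last by apply: eq_Ck IH => // x _; rewrite big_cons Pi.
by apply: eq_Ck (CkD oU (CF i Pi) IH) => // x _; rewrite big_cons Pi.
Qed.

Lemma partial_coord i j x : partial i (fun y => y 0 j) x = (i == j)%:R.
Proof.
have -> : partial i (fun y => y 0 j) x = ('D_(delta_mx 0 i) id x) 0 j.
  by rewrite derive_mx ?mxE.
by rewrite derive_id mxE eqxx eq_sym.
Qed.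

Lemma Ck_coord k U j : open U -> Ck k U (fun x => x 0 j).
Proof.
move=> oU; case: k => [|k]; split => //;
  try by move=> x _; exact: differentiable_coord.
move=> i; apply: eq_Ck (Ck_cst k (i == j)%:R oU) => // x _.
by rewrite partial_coord.
Qed.

End Smooth.

(** * Chain rule *)

Section Composition.
Context {R : realType} {m n : nat}.
Implicit Types (U : set 'rV[R]_m) (V : set 'rV[R]_n).

Lemma differentiable_rV (F : 'rV[R]_m -> 'rV[R]_n) x :
  (forall j, differentiable (fun y => F y 0 j) x) -> differentiable F x.
Proof.
move=> dF.
have -> : F = \sum_(j < n) (fun y => F y 0 j *: 'e_j).
  by apply/funext => y; rewrite fct_sumE {1}[F y]row_sum_delta.
by apply: differentiable_sum => j; apply: differentiableZl.
Qed.

Lemma differentiable_diffE (f : 'rV[R]_n -> R) y v : 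
  differentiable f y -> 'd f y v = \sum_j v 0 j * partial j f y.
Proof.
move=> df; rewrite {1}[v]row_sum_delta linear_sum; apply: eq_bigr => j _.
by rewrite linearZ /partial deriveE.
Qed.

Lemma partial_comp (f : 'rV[R]_n -> R) (F : 'rV[R]_m -> 'rV[R]_n) i x :
  differentiable f (F x) -> (forall j, differentiable (fun y => F y 0 j) x) ->
  partial i (f \o F) x =
  \sum_j partial i (fun y => F y 0 j) x * partial j f (F x).
Proof.
move=> df /differentiable_rV dF.
rewrite /partial deriveE; last exact: differentiable_comp.
rewrite diff_comp//= differentiable_diffE// -deriveE//.
rewrite derive_mx; last exact: diff_derivable.
by apply: eq_bigr => j _; rewrite mxE.
Qed.

(** By the chain rule a partial of [f \o F] is a sum of products of partials of [F] with
    [partial j f \o F]; the induction therefore varies [f] and keeps [F]. *)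
Lemma Ck_comp k U V (f : 'rV[R]_n -> R) (F : 'rV[R]_m -> 'rV[R]_n) :
  open U -> (forall x, U x -> V (F x)) ->
  (forall j, Ck k U (fun y => F y 0 j)) -> Ck k V f -> Ck k U (f \o F).
Proof.
move=> oU UV; elim: k f => [|k IH] f CF Cf.
  split => // x Ux; apply: differentiable_comp.
    by apply: differentiable_rV => j; apply: Ck_differentiable (CF j) Ux.
  by apply: Ck_differentiable Cf _; exact: UV.
split=> [x Ux|i].
  apply: differentiable_comp.
    by apply: differentiable_rV => j; apply: Ck_differentiable (CF j) Ux.
  by apply: Ck_differentiable Cf _; exact: UV.
have : Ck k U (fun x =>
    \sum_j partial i (fun y => F y 0 j) x * partial j f (F x)).
  apply: Ck_sum => // j _; apply: CkM => //; first exact: (CF j).2.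
  by apply: IH; [move=> l; exact: CkS|exact: Cf.2].
apply: eq_Ck => // x /set_mem Ux; rewrite partial_comp//.
  exact: Ck_differentiable Cf (UV _ Ux).
by move=> j; apply: Ck_differentiable (CF j) Ux.
Qed.

End Composition.

(** * Symmetry of second derivatives *)

Section Schwarz.
Context {R : realType} {V : normedModType R}.
Implicit Types (f : V -> R) (x y u v : V).

Lemma is_derive_line f y u (t : R) : derivable f (t *: u + y) u ->
  is_derive t 1 (fun s : R => f (s *: u + y)) ('D_u f (t *: u + y)).
Proof.
have E : (fun h : R => h^-1 *: (f ((h%:A + t) *: u + y) - f (t *: u + y))) =
         (fun h : R => h^-1 *: (f (h *: u + (t *: u + y)) - f (t *: u + y))).
  by apply/funext => h; rewrite scalerDl addrA [h%:A]mulr1.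
by move=> df; apply: DeriveDef; rewrite /derivable /derive E.
Qed.

Lemma MVT_line f y u (s : R) : 0 < s ->
  (forall t, 0 <= t <= s -> derivable f (t *: u + y) u) ->
  exists2 t, 0 <= t <= s & f (s *: u + y) - f y = s * 'D_u f (t *: u + y).
Proof.
move=> s0 df; pose F t := f (t *: u + y).
have dF t : 0 <= t <= s -> is_derive t 1 F ('D_u f (t *: u + y)).
  by move=> /df /is_derive_line.
have [||t ts] := @MVT R F (fun t => 'D_u f (t *: u + y)) 0 s s0.
- by move=> t /[!in_itv]/= /andP[t0 ts]; apply: dF; rewrite !ltW.
- apply: derivable_within_continuous => t /[!in_itv]/= ts.
  by apply: ex_derive; exact: dF.
rewrite /F scale0r add0r subr0 mulrC => ->; exists t => //.
by move: ts; rewrite in_itv/= => /andP[? ?]; rewrite !ltW.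
Qed.

(** The second difference is the increment along [u] of [F y = f (y + s *: v) - f y]. The mean value
    theorem for [F] along [u], then for ['D_u f] along [v], yields the mixed derivative. *)
Lemma second_difference f x u v (s : R) : 0 < s ->
  (forall t t', 0 <= t <= s -> 0 <= t' <= s ->
    derivable f (t *: u + t' *: v + x) u /\
    derivable ('D_u f) (t *: u + t' *: v + x) v) ->
  exists t t', [/\ 0 <= t <= s, 0 <= t' <= s &
    f (s *: u + s *: v + x) - f (s *: u + x) - (f (s *: v + x) - f x) =
    s ^+ 2 * 'D_v ('D_u f) (t *: u + t' *: v + x)].
Proof.
move=> s0 df.
have s00 : 0 <= (0:R) <= s by rewrite lexx ltW.
have ss : 0 <= s <= s by rewrite lexx ltW.
pose F := (fun y => f (y + s *: v)) \- f.
have dF1 t : 0 <= t <= s -> is_derive (t *: u + x) u (fun y => f (y + s *: v))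
   ('D_u f (t *: u + x + s *: v)).
  move=> ts; have [df1 _] := df t s ts ss.
  rewrite addrAC in df1.
  have E : (fun h : R => h^-1 *: (f (h *: u + (t *: u + x) + s *: v) -
                                  f (t *: u + x + s *: v))) =
           (fun h : R => h^-1 *: (f (h *: u + (t *: u + x + s *: v)) -
                                  f (t *: u + x + s *: v))).
    by apply/funext => h; rewrite -addrA.
  by apply: DeriveDef; rewrite /derivable /derive E.
have dF2 t : 0 <= t <= s -> derivable f (t *: u + x) u.
  by move=> ts; have [+ _] := df t 0 ts s00; rewrite scale0r addr0.
have [|t ts] := @MVT_line F x u s s0.
  by move=> t ts; apply: derivableB; [apply: ex_derive; exact: dF1|exact: dF2].
rewrite {1 2}/F /= deriveB; [|by apply: ex_derive; exact: dF1|exact: dF2].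
have [_ ->] := dF1 _ ts.
have [|t' ts'] := @MVT_line ('D_u f) (t *: u + x) v s s0.
  by move=> t' ts'; have [_] := df t t' ts ts'; rewrite addrA [_ *: v + _]addrC.
rewrite [s *: v + (t *: u + x)]addrC => -> E; exists t, t'; split => //.
rewrite expr2 -mulrA [t *: u + _]addrC -[in RHS]addrA -E.
by rewrite [s *: v + x]addrC [s *: u + s *: v + x]addrAC.
Qed.

(** The second difference is symmetric in [u] and [v], so the two mixed derivatives take a common
    value at points close to [x]. By continuity that value is within [e], half the supposed gap, of
    both [A] and [B]. *)
Lemma schwarz f x u v (r : R) : 0 < r ->
  (forall y, ball x r y -> derivable f y u /\ derivable f y v) ->
  (forall y, ball x r y -> derivable ('D_u f) y v /\ derivable ('D_v f) y u) ->
  {for x, continuous ('D_v ('D_u f))} -> {for x, continuous ('D_u ('D_v f))} ->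
  'D_v ('D_u f) x = 'D_u ('D_v f) x.
Proof.
move=> r0 d1 d2 c1 c2; apply/eqP/negPn/negP => neq.
set A := 'D_v ('D_u f) x; set B := 'D_u ('D_v f) x.
pose e := `|A - B| / 2.
have e0 : 0 < e by rewrite divr_gt0// normr_gt0 subr_eq0.
have /nbhs_ballP[r' /= r'0 br'] : nbhs x [set y | `|A - 'D_v ('D_u f) y| < e /\
   `|B - 'D_u ('D_v f) y| < e].
  apply: filterI; first by move/cvgrPdist_lt : c1; apply.
  by move/cvgrPdist_lt : c2; apply.
pose d := Num.min r r'.
have d0 : 0 < d by rewrite lt_min r0.
(* The summand 1 keeps [C] positive and makes the sampled points lie strictly inside the ball of
   radius [d = s * C]. *)
pose C := `|u| + `|v| + 1.
have C0 : 0 < C by rewrite ltr_wpDl// addr_ge0.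
pose s := d / C.
have s0 : 0 < s by rewrite divr_gt0.
have B1 t t' : 0 <= t <= s -> 0 <= t' <= s -> `|t *: u + t' *: v| < d.
  move=> /andP[t0 ts] /andP[t0' ts'].
  have -> : d = s * C by rewrite divfK// gt_eqF.
  rewrite (le_lt_trans (ler_normD _ _))// !normrZ !ger0_norm// /C !mulrDr mulr1.
  by rewrite ltr_pwDr// lerD// ler_wpM2r.
have Bx t t' : 0 <= t <= s -> 0 <= t' <= s -> ball x d (t *: u + t' *: v + x).
  by move=> ts ts'; rewrite -ball_normE/= distrC addrK B1.
have Bl y : ball x d y -> ball x r y by apply: le_ball; rewrite ge_min lexx.
have Bl' y : ball x d y -> ball x r' y.
  by apply: le_ball; rewrite ge_min lexx orbT.
have [|t1 [t1' [h1 h1' E1]]] := @second_difference f x u v s s0.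
  by move=> t t' ts ts'; split; [apply: (d1 _ _).1|apply: (d2 _ _).1];
    apply/Bl/Bx.
have [|t2 [t2' [h2 h2' E2]]] := @second_difference f x v u s s0.
  move=> t t' ts ts'; rewrite [t *: v + _]addrC.
  by split; [apply: (d1 _ _).2|apply: (d2 _ _).2]; apply/Bl/Bx.
have /br'[/= H1 _] := Bl' _ (Bx _ _ h1 h1').
have /br'[/= _ H2] := Bl' _ (Bx _ _ h2' h2).
rewrite (addrC (t2' *: u)) in H2.
have E : 'D_v ('D_u f) (t1 *: u + t1' *: v + x) =
         'D_u ('D_v f) (t2 *: v + t2' *: u + x).
  rewrite (addrC (s *: v)) in E2.
  apply: (@mulfI _ (s ^+ 2)); first by rewrite expf_neq0// gt_eqF.
  apply: etrans (etrans (esym E1) _) E2.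
  by move: (f _) (f _) (f _) (f _) => ? ? ? ?; ring.
rewrite E in H1.
have : `|A - B| < e + e.
  move: H1 H2; move: ('D_u _ _) => w H1; rewrite distrC => H2.
  by rewrite -(subrKA w) (le_lt_trans (ler_normD _ _))// ltrD.
by rewrite /e -splitr ltxx.
Qed.

End Schwarz.

Lemma Ck_schwarz (R : realType) n (U : set 'rV[R]_n) (f : 'rV[R]_n -> R) i j x :
  open U -> Ck 2 U f -> U x ->
  partial i (partial j f) x = partial j (partial i f) x.
Proof.
move=> oU [df pf] Ux.
have /nbhs_ballP[r /= r0 rU] : nbhs x U.
  exact: open_nbhs_nbhs.
apply: (schwarz r0).
- by move=> y /rU Uy; split; apply: diff_derivable; exact: df.
- by move=> y /rU Uy; split; apply: diff_derivable; exact: (pf _).1.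
- by apply: differentiable_continuous; exact: ((pf j).2 i).1.
- by apply: differentiable_continuous; exact: ((pf i).2 j).1.
Qed.

(** * Flat functions *)

Section Flat.
Context {R : realType}.
Implicit Types (p : {poly R}) (t : R).

(** For [0 <= t] the exponential dominates each single term of its power series. *)
Lemma exp_expRN_le (k : nat) t : 0 <= t -> t ^+ k * expR (- t) <= k`!%:R.
Proof.
move=> t0; rewrite expRN ler_pdivrMr ?expR_gt0//.
case: k => [|k]; first by rewrite expr0 mul1r -expR0 ler_expR.
have k0 : 0 < (k.+1)`!%:R :> R by rewrite ltr0n fact_gt0.
rewrite -ler_pdivrMl// mulrC (le_trans _ (expR_ge1Dxn k t0))//.
by rewrite lerDr.
Qed.

Lemma horner_expRN_bounded p :
  exists C, forall t, 0 <= t -> `|p.[t] * expR (- t)| <= C.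
Proof.
exists (\sum_(i < size p) `|p`_i| * i`!%:R) => t t0.
rewrite horner_coef mulr_suml (le_trans (ler_norm_sum _ _ _))//.
apply: ler_sum => i _; rewrite -mulrA normrM ler_wpM2l//.
by rewrite ger0_norm ?exp_expRN_le// mulr_ge0 ?exprn_ge0 ?expR_ge0.
Qed.

(** For [p = 1] this is the classical [exp(-1/t)] extended by zero; the polynomial factor makes the
    family closed under differentiation. *)
Definition flat p t : R := if 0 < t then p.[t^-1] * expR (- t^-1) else 0.

(** With [s = 1/t], the derivative of [p(s) exp(-s)] with respect to [t] is
    [s^2 (p(s) - p'(s)) exp(-s)]. *)
Definition dflat p : {poly R} := 'X^2 * (p - p^`()).

Lemma is_derive_flat p t : is_derive t 1 (flat p) (flat (dflat p) t).
Proof.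
have [t0|t0|->] := ltgtP t 0; rewrite [flat (dflat p) _]/flat.
- rewrite ltNge ltW//=; apply: (@near_eq_is_derive _ _ _ (cst 0)).
  near=> s; rewrite /flat ltNge ltW//=; near: s; exact: lt_nbhsl.
- rewrite t0; have tn0 : t != 0 by rewrite gt_eqF.
  apply: (@near_eq_is_derive _ _ _
     ((horner p \o GRing.inv) * (expR \o (-%R \o GRing.inv)))).
    near=> s; rewrite /flat ifT//; near: s; exact: lt_nbhsr.
  have dV : is_derive t 1 (@GRing.inv R) (- t ^- 2).
    have := is_deriveV tn0 (is_derive_id t 1).
    by rewrite [_ *: _]mulr1.
  have dNV := is_deriveN dV.
  apply: is_derive_eq (is_deriveM (is_derive1_comp (is_derive_poly p _) dV)
    (is_derive1_comp (is_derive_expR _) dNV)) _.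
  rewrite /dflat !hornerE /= exprVn /GRing.scale /=. ring.
rewrite ltxx.
(* For [h > 0] the difference quotient at 0 is [h] times the value of [s^2 p(s) exp(-s)] at
   [s = 1/h], so a bound on the latter makes it tend to 0. Passing from [C] to [|C| + 1] gives a
   positive divisor. *)
have [C HC] := horner_expRN_bounded ('X^2 * p).
have C0 : 0 < `|C| + 1 by rewrite ltr_wpDl.
suff H : (fun h : R => h^-1 *: (flat p (h *: 1 + 0) - flat p 0)) @ 0^'
    --> (0 : R).
  by apply: DeriveDef; [exact: cvgP H|exact: cvg_lim H].
apply/cvgrPdist_le => e e0.
have d0 : 0 < e / (`|C| + 1) by rewrite divr_gt0.
near=> h.
rewrite sub0r normrN addr0 [h%:A]mulr1 {2}/flat ltxx subr0 /flat.
case: ifPn => [h0|_]; last by rewrite scaler0 normr0 ltW.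
have hn0 : h != 0 by rewrite gt_eqF.
have -> : h^-1 *: (p.[h^-1] * expR (- h^-1)) =
    ('X^2 * p).[h^-1] * expR (- h^-1) * h.
  by rewrite !hornerE /GRing.scale /=; field.
rewrite normrM (@le_trans _ _ ((`|C| + 1) * `|h|))//.
  rewrite ler_wpM2r//; apply: le_trans (HC _ _) _;
  first by rewrite invr_ge0 ltW.
  by rewrite (le_trans (ler_norm C))// ltW// ltrDl.
rewrite mulrC -ler_pdivlMr//; near: h.
exact: dnbhs0_le.
Unshelve. all: by end_near.
Qed.

Lemma differentiable_flat p t : differentiable (flat p) t.
Proof. by apply/derivable1_diffP; have [] := is_derive_flat p t. Qed.

(** Each derivative replaces [p] by [dflat p], so the induction runs over all polynomials at
    once. *)
Lemma Ck_flat n k (U : set 'rV[R]_n) (F : 'rV[R]_n -> R) p :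
  open U -> Ck k U F -> Ck k U (flat p \o F).
Proof.
move=> oU; elim: k p => [|k IH] p CF.
  split => // x Ux; apply: differentiable_comp (differentiable_flat _ _).
  exact: Ck_differentiable CF Ux.
split=> [x Ux|i].
  apply: differentiable_comp (differentiable_flat _ _).
  exact: Ck_differentiable CF Ux.
apply: eq_Ck (CkM oU (IH (dflat p) (CkS CF)) (CF.2 i)) => // x /set_mem Ux.
have dF := Ck_differentiable CF Ux.
rewrite /partial [RHS]deriveE;
  last exact: differentiable_comp (differentiable_flat _ _).
rewrite diff_comp//=; last exact: differentiable_flat.
rewrite diff1E; last exact: differentiable_flat.
rewrite derive1E; have [_ ->] := is_derive_flat p (F x).
by rewrite -deriveE// mulrC.
Qed.

End Flat.

(** * Extension of tangent vectors to vector fields *)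

Lemma jacobianE (R : realType) m n (F : 'rV[R]_m -> 'rV[R]_n) x k l :
  (forall j, differentiable (fun y => F y 0 j) x) ->
  jacobian F x k l = partial k (fun y => F y 0 l) x.
Proof.
move=> /differentiable_rV dF.
rewrite /jacobian mxE -deriveE// derive_mx ?mxE//.
exact: diff_derivable.
Qed.

Section Extension.
Context {R : realType} {n : nat} {M : manifold R n}.
Implicit Types (a b c : chart M) (q : M) (x : 'rV[R]_n).

(** [psi a] is continuous only within the chart image; as that image is open, relatively open
    subsets of it are open. *)
Lemma open_preimage_psi a (A : set M) : open A ->
  open (phi a @` dom a `&` (psi a @^-1` A)).
Proof.
move=> oA; rewrite setIC open_setIS; last exact: phi_open.
by have /continuousP := @psi_continuous _ _ M a; apply.
Qed.

Definition overlap a b := phi a @` (dom a `&` dom b).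

Lemma overlapE a b : overlap a b = phi a @` dom a `&` (psi a @^-1` dom b).
Proof.
apply/seteqP; split => x /=.
  by move=> [q [qa qb] <-]; split; [exists q|rewrite phiK].
by move=> [[q qa <-]]; rewrite phiK// => qb; exists q.
Qed.

Lemma open_overlap a b : open (overlap a b).
Proof. by rewrite overlapE; apply: open_preimage_psi; exact: dom_open. Qed.

Lemma transition_Ck k a b j : Ck k (overlap a b) (fun x => phi b (psi a x) 0 j).
Proof. by have /smooth_onP := @transition_smooth _ _ M a b j; apply. Qed.

Lemma transition_differentiable a b q j : dom a q -> dom b q ->
  differentiable (fun x => phi b (psi a x) 0 j) (phi a q).
Proof.
by move=> qa qb; apply: Ck_differentiable (transition_Ck 0 a b j) _; exists q.
Qed.

Lemma transition_jacobianE a b q k l : dom a q -> dom b q ->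
  transition_jacobian a b q k l =
  partial k (fun x => phi b (psi a x) 0 l) (phi a q).
Proof.
move=> qa qb; apply: (@jacobianE _ _ _ (phi b \o psi a)) => j.
exact: transition_differentiable.
Qed.

(** Chain rule for the factorization through chart [b], which is valid on [overlap a b]. Since
    Jacobians act on row vectors, the factors appear in the order in which the charts are
    traversed. *)
Lemma transition_jacobian_comp a b c q : dom a q -> dom b q -> dom c q ->
  transition_jacobian a c q =
    transition_jacobian a b q *m transition_jacobian b c q.
Proof.
move=> qa qb qc; apply/matrixP => k l.
rewrite transition_jacobianE//.
rewrite [RHS]mxE.
have -> : partial k (fun x => phi c (psi a x) 0 l) (phi a q) =
    partial k ((fun x => phi c (psi b x) 0 l) \o (phi b \o psi a)) (phi a q).
  apply: near_eq_derive; apply: (@open_nearP _ _ (overlap a b)).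
  - exact: open_overlap.
  - move=> x /set_mem[q' [q'a q'b] <-] /=.
    by rewrite (phiK q'a) (phiK q'b).
  - by exists q.
rewrite partial_comp; last 2 first.
- rewrite /= phiK//; exact: transition_differentiable.
- by move=> j; exact: transition_differentiable.
apply: eq_bigr => j _; rewrite /= phiK//; congr (_ * _).
  by rewrite -jacobianE// => j'; exact: transition_differentiable.
by rewrite -jacobianE// => j'; exact: transition_differentiable.
Qed.

Lemma transition_jacobian_id a q : dom a q -> transition_jacobian a a q = 1%:M.
Proof.
move=> qa; apply/matrixP => k l.
rewrite transition_jacobianE//.
rewrite mxE -(partial_coord k l (phi a q)).
apply: near_eq_derive; apply: (@open_nearP _ _ (overlap a a)).
- exact: open_overlap.
- by move=> x /set_mem[q' [q'a _] <-] /=; rewrite phiK.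
- by exists q.
Qed.

(** * Vector fields supported in a ball of one chart *)

Section Bump.
Variables (i : chart M) (x0 v : 'rV[R]_n) (r : R).
Hypothesis r0 : 0 < r.
Hypothesis sub_r : closed_ball x0 r `<=` phi i @` dom i.

(** This is [r^2 - |x - x0|^2] for the Euclidean norm, a polynomial in the coordinates, unlike the
    sup norm that defines [ball]. *)
Let t x : R := r ^+ 2 + -1 * \sum_k (x 0 k + - x0 0 k) * (x 0 k + - x0 0 k).

Let Ck_t k U : open U -> Ck k U t.
Proof.
move=> oU; apply: CkD => //; first exact: Ck_cst.
apply: CkM => //; first exact: Ck_cst.
by apply: Ck_sum => // l _; apply: CkM => //; (apply: CkD => //;
  [exact: Ck_coord|exact: Ck_cst]).
Qed.

(** Every coordinate is bounded by the Euclidean norm, so the Euclidean ball lies in the sup-norm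
    ball. *)
Let t_ball x : 0 < t x -> ball x0 r x.
Proof.
move=> tx; split=> // a b; rewrite (ord1 a) -ball_normE /=.
rewrite -(ltr_pXn2r (ltn0Sn 1)) ?nnegrE ?normr_ge0 ?(ltW r0)//.
rewrite real_normK ?num_real//.
apply: (@le_lt_trans _ _ (\sum_k (x 0 k + - x0 0 k) * (x 0 k + - x0 0 k))).
  rewrite (bigD1 b)//= -!expr2 -(sqrrN (x0 _ _ - _))
    opprB lerDl sumr_ge0// => k _.
  by rewrite sqr_ge0.
by move: tx; rewrite /t mulN1r subr_gt0.
Qed.

Let bump x := flat 1 (t x).

Let bump_out x : bump x != 0 -> closed_ball x0 r x.
Proof.
rewrite /bump /flat; case: ifPn => [/t_ball + _|]; last by rewrite eqxx.
exact: subset_closed_ball.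
Qed.

Let K := psi i @` closed_ball x0 r.

(** [K] is a continuous image of a compact ball, hence compact, hence closed in the Hausdorff space
    [M]. So the complement of [K], where the bump field is zero, is open. *)
Let closed_K : closed K.
Proof.
apply: compact_closed; first exact: mfd_hausdorff.
apply: continuous_compact.
  apply: continuous_subspaceW sub_r _; exact: psi_continuous.
apply: bounded_closed_compact; last exact: closed_ball_closed.
rewrite closed_ballE//; exists (`|x0| + r); split; first exact: num_real.
move=> m lt_m x /= xr; rewrite -(subrK x0 x) (le_trans (ler_normD _ _))//.
by rewrite (le_trans _ (ltW lt_m))// addrC lerD2l distrC.
Qed.

(** The field that chart [i] sees as [bump x *: v], transported to chart [b]. *)
Let field (b : chart M) (q : M) : 'rV[R]_n :=
  if `[< dom i q >] then bump (phi i q) *: (v *m transition_jacobian i b q)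
  else 0.

Let field_change b c q : dom b q -> dom c q ->
  field c q = field b q *m transition_jacobian b c q.
Proof.
move=> qb qc; rewrite /field; case: asboolP => [qi|_]; last by rewrite mul0mx.
by rewrite -scalemxAl -mulmxA -transition_jacobian_comp.
Qed.

Let field_smooth b l :
  smooth_on (phi b @` dom b) (fun x => field b (psi b x) 0 l).
Proof.
move=> s x Ux; have [xi|xNi] := pselect (dom i (psi b x)).
(* Over [dom i] the component is an explicit function [G] of the coordinates of chart [i], composed
   with the transition map. *)
- suff : smooth_on (overlap b i) (fun x => field b (psi b x) 0 l).
    by apply; rewrite overlapE.
  apply/smooth_onP => k.
  pose G y := bump y *
    \sum_j v 0 j * partial j (fun z => phi b (psi i z) 0 l) y.
  apply: (@eq_Ck _ _ _ _ (G \o (phi i \o psi b))); first exact: open_overlap.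
    move=> _ /set_mem[q [qb qi] <-] /=; rewrite phiK// /field asboolT//.
    rewrite !mxE /G; congr (_ * _); apply: eq_bigr => j _; congr (_ * _).
    by rewrite transition_jacobianE// phiK.
  apply: (@Ck_comp _ _ _ _ _ (overlap i b)).
  + exact: open_overlap.
  + by move=> _ [q [qb qi] <-] /=; exists q => //; rewrite phiK.
  + by move=> j; exact: transition_Ck.
  + apply: CkM; first exact: open_overlap.
      by apply: Ck_flat (Ck_t _ _); exact: open_overlap.
    apply: Ck_sum; first exact: open_overlap.
    move=> j _; apply: CkM; [exact: open_overlap| |].
      by apply: Ck_cst; exact: open_overlap.
    (* One order more is taken because [G] contains first partials of the transition map. *)
    by have [_] := transition_Ck k.+1 i b l; apply.
(* A point outside [dom i] is outside [K], and the component is identically zero over the open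
   complement of [K]. *)
- have oW := @open_preimage_psi b _ (closed_openC closed_K).
  suff : smooth_on (phi b @` dom b `&` psi b @^-1` (~` K))
             (fun x => field b (psi b x) 0 l).
    apply; split => // -[y /sub_r[q qi <-]]; rewrite phiK// => qx.
    by rewrite -qx in xNi.
  apply/smooth_onP => k; apply: eq_Ck (Ck_cst k 0 oW) => // y /set_mem[_ /= yK].
  rewrite /field; case: asboolP => [yi|_]; last by rewrite mxE.
  have [->|/bump_out bK] := eqVneq (bump (phi i (psi b y))) 0.
    by rewrite scale0r mxE.
  by case: yK; exists (phi i (psi b y)) => //; rewrite phiK.
Qed.

Definition bump_field := VectorField field_change field_smooth.

Lemma bump_fieldE q : dom i q -> phi i q = x0 ->
  bump_field i q = expR (- (r ^+ 2)^-1) *: v.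
Proof.
move=> qi qx; rewrite /= /field asboolT// transition_jacobian_id// mulmx1 qx.
have tE : t x0 = r ^+ 2.
  by rewrite /t big1 ?mulr0 ?addr0// => k _; rewrite subrr mulr0.
by rewrite /bump /flat tE exprn_gt0// hornerC mul1r.
Qed.

End Bump.

(** At its centre a bump field is a positive multiple of the prescribed vector, so [v] is rescaled
    beforehand. Halving the radius makes the closed ball fit into the chart image. *)
Lemma vector_field_extension a q (v : 'rV[R]_n) : dom a q ->
  exists X : vector_field M, X a q = v.
Proof.
move=> qa; have /nbhs_ballP[r /= r0 rU] : nbhs (phi a q) (phi a @` dom a).
  by apply: open_nbhs_nbhs; split; [exact: phi_open|exists q].
have r20 : 0 < r / 2 by rewrite divr_gt0.
have sub : closed_ball (phi a q) (r / 2) `<=` phi a @` dom a.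
  exact: subset_trans (subset_closure_half r0) rU.
exists (bump_field ((expR (- ((r / 2) ^+ 2)^-1))^-1 *: v) r20 sub).
by rewrite bump_fieldE// scalerA divff ?scale1r// gt_eqF// expR_gt0.
Qed.

End Extension.

(** * Contractions *)

Lemma linear_rVE (R : pzRingType) n (f : 'rV[R]_n -> R) w :
  (forall k x y, f (k *: x + y) = k * f x + f y) ->
  f w = \sum_j w 0 j * f 'e_j.
Proof.
move=> f_lin; have f0 : f 0 = 0.
  by have := f_lin (-1) 0 0; rewrite scaler0 addr0 mulN1r addNr.
rewrite {1}[w]row_sum_delta.
elim: (index_enum _) => [|j s IH]; first by rewrite !big_nil.
by rewrite !big_cons f_lin IH.
Qed.

Section Contraction.
Context {R : realType} {n : nat}.
Local Notation V := 'rV[R]_n.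
Variable G : 'M[R]_n.
Hypothesis G_sym : G^T = G.
Hypothesis G_unit : G \in unitmx.
Implicit Types (F H : V -> V -> R) (x y z u w : V).
Local Notation g := (inner G).

Lemma inner_sym x y : g x y = g y x.
Proof.
rewrite /inner -[RHS]trace_mx11 -mxtrace_tr trace_mx11.
by rewrite !trmx_mul trmxK G_sym mulmxA.
Qed.

Lemma invmx_sym (a b : 'I_n) : invmx G a b = invmx G b a.
Proof. by rewrite -{1}G_sym -trmx_inv mxE. Qed.

(** The [g]-trace. [F] is a plain function of two vectors; linearity is requested only by the lemmas
    that use it. *)
Definition contr F : R :=
  \sum_(a < n) \sum_(b < n) invmx G a b * F 'e_a 'e_b.

Lemma eq_contr F H : (forall x y, F x y = H x y) -> contr F = contr H.
Proof.
by move=> FH; apply: eq_bigr => a _; apply: eq_bigr => b _; rewrite FH.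
Qed.

Lemma contrD F H : contr (fun x y => F x y + H x y) = contr F + contr H.
Proof.
rewrite /contr -big_split; apply: eq_bigr => a _ /=; rewrite -big_split.
by apply: eq_bigr => b _ /=; rewrite mulrDr.
Qed.

Lemma contrZ k F : contr (fun x y => k * F x y) = k * contr F.
Proof.
rewrite /contr mulr_sumr; apply: eq_bigr => a _; rewrite mulr_sumr.
by apply: eq_bigr => b _; rewrite mulrCA.
Qed.

Lemma contrN F : contr (fun x y => - F x y) = - contr F.
Proof. by under eq_contr do rewrite -mulN1r; rewrite contrZ mulN1r. Qed.

Lemma contr_swap F : contr F = contr (fun x y => F y x).
Proof.
rewrite /contr exchange_big; apply: eq_bigr => a _; apply: eq_bigr => b _.
by rewrite invmx_sym.
Qed.

(** [G] cancels against [invmx G], so contracting with [g u] substitutes [u]; the metric factors of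
    the cyclic identity are absorbed in this way. *)
Lemma contr_inner (f : V -> R) u :
  (forall k x y, f (k *: x + y) = k * f x + f y) ->
  contr (fun x y => g u x * f y) = f u.
Proof.
move=> f_lin; rewrite [RHS]linear_rVE// /contr exchange_big;
apply: eq_bigr => b _ /=.
under eq_bigr do rewrite mulrA.
rewrite -mulr_suml; congr (_ * _).
transitivity ((u *m G *m invmx G) 0 b); last by rewrite mulmxK.
rewrite mxE; apply: eq_bigr => a _; rewrite mulrC; congr (_ * _).
by rewrite /inner trmx_delta -colE !mxE.
Qed.

Lemma contr_innern : contr (fun x y => g x y) = n%:R.
Proof.
transitivity (\sum_a ((G *m invmx G) a a)).
  apply: eq_bigr => a _; rewrite mxE; apply: eq_bigr => b _.
  rewrite mulrC invmx_sym; congr (_ * _).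
  by rewrite /inner trmx_delta -colE -rowE !mxE.
rewrite mulmxV// -[RHS](@mxtrace1 R n); apply: eq_bigr => a _.
by rewrite !mxE.
Qed.

(** * Vanishing of a tensor that satisfies the cyclic identity *)

Section Cyclic.
(** [T a b c d] stands for [(R . S)(a, b; c, d)]. Linearity in slots 2 and 4 follows from slots 1
    and 3 by the two symmetries. *)
Variable T : V -> V -> V -> V -> R.
Hypothesis T_sym : forall a b c d, T a b c d = T b a c d.
Hypothesis T_alt : forall a b c d, T a b c d = - T a b d c.
Hypothesis T_lin1 : forall k x y b c d,
  T (k *: x + y) b c d = k * T x b c d + T y b c d.
Hypothesis T_lin3 : forall k x y a b d,
  T a b (k *: x + y) d = k * T a b x d + T a b y d.

Lemma cyclic_eq0 : (2 <= n)%N ->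
  (forall x1 x2 x3 x4 x5 x6,
    g x1 x4 * T x2 x3 x5 x6 - g x2 x4 * T x1 x3 x5 x6 +
    (g x3 x6 * T x4 x5 x1 x2 - g x4 x6 * T x3 x5 x1 x2) +
    (g x5 x2 * T x6 x1 x3 x4 - g x6 x2 * T x5 x1 x3 x4) = 0) ->
  forall a b c d, T a b c d = 0.
Proof.
move=> n2 E0.
have T_lin2 k x y a c d : T a (k *: x + y) c d = k * T a x c d + T a y c d.
  by rewrite T_sym T_lin1 !(T_sym a).
pose A u w := contr (fun x y => T x u y w).
have A_lin1 k x y w : A (k *: x + y) w = k * A x w + A y w.
  by rewrite /A -contrZ -contrD; apply: eq_contr => *; rewrite T_lin2.
have A_lin2 k x y w : A w (k *: x + y) = k * A w x + A w y.
  rewrite /A -contrZ -contrD; apply: eq_contr => u z.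
  by rewrite T_alt T_lin3 (T_alt _ _ z x) (T_alt _ _ z y) opprD mulrN.
(* The hypothesis contracted over [x1] and [x4], with [x2, x3, x5, x6] renamed to [a, b, c, d]. *)
have E1 a b c d : (n%:R - 1) * T a b c d + g b d * A c a - T b c d a -
    g c a * A d b + g d a * A c b = 0.
  have : contr (fun x y =>
    g x y * T a b c d - g a y * T x b c d +
    (g b d * T y c x a - g y d * T b c x a) +
    (g c a * T d x b y - g d a * T c x b y)) = 0.
    by rewrite /contr big1// => i _; rewrite big1// => j _; rewrite E0 mulr0.
  rewrite !contrD !contrN !contrZ.
  have -> : contr (fun x y => g x y * T a b c d) = n%:R * T a b c d.
    by under eq_contr do rewrite mulrC; rewrite contrZ contr_innern mulrC.
  have -> : contr (fun x y => g a y * T x b c d) = T a b c d.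
    by rewrite contr_swap (contr_inner (f := fun x => T x b c d)).
  have -> : contr (fun x y => T y c x a) = A c a by rewrite contr_swap.
  have -> : contr (fun x y => g y d * T b c x a) = T b c d a.
    rewrite contr_swap; under eq_contr do rewrite inner_sym.
    by rewrite (contr_inner (f := fun x => T b c x a)).
  have EA u w : contr (fun x y => T u x w y) = - A u w.
    by rewrite -contrN; apply: eq_contr => x y; rewrite T_sym T_alt.
  rewrite !EA => <-; ring.
(* [E1] contracted over [a] and [d]. *)
have E2 b c : (n%:R - 1) * A b c = n%:R * A c b.
  have : contr (fun x y => (n%:R - 1) * T x b c y + g b y * A c x - T b c y x -
    g c x * A y b + g y x * A c b) = 0.
    by rewrite /contr big1// => i _; rewrite big1// => j _; rewrite E1 mulr0.
  rewrite !contrD !contrN !contrZ.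
  have -> : contr (fun x y => T x b c y) = - A b c.
    by rewrite -contrN; apply: eq_contr => x y; rewrite T_alt.
  have -> : contr (fun x y => g b y * A c x) = A c b.
    by rewrite contr_swap (contr_inner (f := A c)).
  have -> : contr (fun x y => T b c y x) = 0.
    (* The form is skew in the contracted arguments, so its trace equals its own opposite. *)
    apply/eqP; rewrite -[_ == 0](mulrn_eq0 _ 2) mulr2n.
    rewrite {1}contr_swap -contrD /contr big1// => i _.
    by rewrite big1// => j _; rewrite T_alt addNr mulr0.
  rewrite (contr_inner (f := A ^~ b))//.
  have -> : contr (fun x y => g y x * A c b) = n%:R * A c b.
    under eq_contr do rewrite mulrC inner_sym.
    by rewrite contrZ contr_innern mulrC.
  move=> H; apply/eqP; rewrite -subr_eq0 -oppr_eq0 -[X in _ == X]H.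
  by apply/eqP; ring.
have n2R : 2 <= n%:R :> R by rewrite ler_nat.
(* Using [E2] twice gives [(n - 1)^2 A b c = n^2 A b c], that is [(2 n - 1) A b c = 0]. *)
have A0 b c : A b c = 0.
  have := E2 b c; have := E2 c b => H1 H2.
  have : (2 * n%:R - 1) * A b c = 0.
    have : (n%:R - 1) * ((n%:R - 1) * A b c) = n%:R * (n%:R * A b c).
      by rewrite H2 mulrCA H1.
    move=> /eqP; rewrite -subr_eq0 => /eqP H3.
    by apply: oppr_inj; rewrite oppr0 -H3; ring.
  by move=> /eqP; rewrite mulf_eq0 => /orP[/eqP|/eqP//]; lra.
have E3 a b c d : (n%:R - 1) * T a b c d = T b c d a.
  by have := E1 a b c d; rewrite !A0; lra.
move=> a b c d.
(* By symmetry in [a] and [b], [E3 a b c d] and [E3 b a c d] have equal right-hand sides. The first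
   is [- T b c a d]; the second equals [(n - 1) T b c a d] by [E3 b c a d]. *)
have bc0 : T b c a d = 0.
  have : n%:R * T b c a d = 0.
    have := E3 a b c d; have := E3 b a c d; have := E3 b c a d.
    rewrite (T_sym b a) (T_sym c a) (T_alt b c d); lra.
  by move=> /eqP; rewrite mulf_eq0 => /orP[/eqP|/eqP//]; lra.
have := E3 a b c d; rewrite (T_alt b c) bc0 oppr0 => /eqP.
by rewrite mulf_eq0 => /orP[/eqP|/eqP//]; lra.
Qed.

End Cyclic.
End Contraction.

(** * The algebra of curvature tensors at a point *)

Definition curry2 (R : realType) n (H : tensor R n 2) x y := H [tuple x; y].

Definition curry4 (R : realType) n (H : tensor R n 4) x y z w :=
  H [tuple x; y; z; w].

Section TensorDot.
Context {R : realType} {n : nat}.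
Local Notation V := 'rV[R]_n.
Variables (G : 'M[R]_n) (D : tensor R n 4).
Implicit Types (x y z w u a b c d : V).

Lemma tensor_dot2 (H : tensor R n 2) a b y z :
  tensor_dot G D H [tuple a; b] y z =
  - (H [tuple raise G D y z a; b] + H [tuple a; raise G D y z b]).
Proof.
rewrite /tensor_dot !big_ord_recl big_ord0 addr0; congr (- (H _ + H _));
  by apply: eq_from_tnth => -[[|[|//]] i]; rewrite tnth_mktuple.
Qed.

Lemma tensor_dot4 (H : tensor R n 4) a b c d y z :
  tensor_dot G D H [tuple a; b; c; d] y z =
  - (H [tuple raise G D y z a; b; c; d] + H [tuple a; raise G D y z b; c; d] +
     H [tuple a; b; raise G D y z c; d] + H [tuple a; b; c; raise G D y z d]).
Proof.
rewrite /tensor_dot !big_ord_recl big_ord0 addr0 !addrA.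
congr (- (H _ + H _ + H _ + H _));
  by apply: eq_from_tnth => -[[|[|[|[|//]]]] i]; rewrite tnth_mktuple.
Qed.

Local Notation Q := (curry4 D).
Local Notation g := (inner G).
Hypothesis G_sym : G^T = G.
Hypothesis G_unit : G \in unitmx.
Hypothesis D_lin : forall k x x' y z w,
  Q (k *: x + x') y z w = k * Q x y z w + Q x' y z w.
Hypothesis D_alt : forall x y z w, Q x y z w = - Q x y w z.
Hypothesis D_pair : forall x y z w, Q x y z w = Q z w x y.

Let D_alt12 x y z w : Q x y z w = - Q y x z w.
Proof. by rewrite D_pair D_alt D_pair. Qed.

Let D_lin2 k x x' y z w :
  Q y (k *: x + x') z w = k * Q y x z w + Q y x' z w.
Proof. by rewrite !(D_alt12 y) D_lin opprD mulrN. Qed.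

Let D_lin3 k x x' y z w :
  Q y z (k *: x + x') w = k * Q y z x w + Q y z x' w.
Proof. by rewrite !(D_pair y) D_lin. Qed.

Let D_lin4 k x x' y z w :
  Q y z w (k *: x + x') = k * Q y z w x + Q y z w x'.
Proof. by rewrite !(D_alt y z w) D_lin3 opprD mulrN. Qed.

Local Notation r := (raise G D).
Local Notation S := (curry2 (ricci G D)).

Let inner_raise x y z w : g (r x y z) w = Q x y z w.
Proof.
rewrite /inner /raise mulmxKV// mxE [RHS](@linear_rVE _ _ (Q x y z)).
  by apply: eq_bigr => j _; rewrite !mxE mulrC.
by move=> k w1 w2; exact: D_lin4.
Qed.

Let raise_alt x y z : r x y z = - r y x z.
Proof.
rewrite /raise -mulNmx; congr (_ *m _).
by apply/rowP => j; rewrite !mxE; exact: D_alt12.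
Qed.

Let raise_lin1 k x x' y z : r (k *: x + x') y z = k *: r x y z + r x' y z.
Proof.
rewrite /raise scalemxAl -mulmxDl; congr (_ *m _).
by apply/rowP => j; rewrite !mxE; exact: D_lin.
Qed.

Let raise_lin3 k x x' y z : r y z (k *: x + x') = k *: r y z x + r y z x'.
Proof.
rewrite /raise scalemxAl -mulmxDl; congr (_ *m _).
by apply/rowP => j; rewrite !mxE; exact: D_lin3.
Qed.

(** The curvature endomorphism [r x y] is skew for [g], which is the identity [R . g = 0]. *)
Let raise_skew x y z w : g (r x y z) w = - g z (r x y w).
Proof. by rewrite (inner_sym G_sym z) !inner_raise D_alt. Qed.

Let ricciE a b : S a b = contr G (fun x y => Q x a b y).
Proof. by []. Qed.

Let ricci_sym a b : S a b = S b a.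
Proof.
rewrite !ricciE (contr_swap G_sym); apply: eq_contr => x y.
by rewrite D_pair D_alt D_alt12 opprK.
Qed.

Let ricci_lin k a a' b : S (k *: a + a') b = k * S a b + S a' b.
Proof.
by rewrite !ricciE -contrZ -contrD; apply: eq_contr => x y; rewrite D_lin2.
Qed.

Local Notation RS a b c d := (tensor_dot G D (ricci G D) [tuple a; b] c d).

Let RSE a b c d : RS a b c d = - (S (r c d a) b + S a (r c d b)).
Proof. exact: tensor_dot2. Qed.

Local Notation RP a b c d x y :=
  (tensor_dot G D (projective G D) [tuple a; b; c; d] x y).

Let projectiveE a b c d : projective G D [tuple a; b; c; d] =
  Q a b c d - (n%:R - 1)^-1 * (S b c * g a d - S a c * g b d).
Proof. by []. Qed.

(* The (R . R)-part of the cyclic sum cancels in pairs once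
   written through [q]. *)
Let q a b c d x y := g (r a b (r c d x)) y.

(** By pair symmetry and skewness the four terms of [R . R] become values of [q]; the first two form
    [g([R(c,d), R(x,y)] a, b)], the others the same with the pairs [a, b] and [c, d] exchanged. In
    the correction term the derivation acts on [S] alone, because [R . g = 0]. *)
Let RPE a b c d x y : RP a b c d x y =
  - (q c d x y a b - q x y c d a b + q a b x y c d - q x y a b c d)
  - (n%:R - 1)^-1 * (g a d * RS b c x y - g b d * RS a c x y).
Proof.
rewrite tensor_dot4 !projectiveE !RSE.
rewrite (raise_skew x y a d) (raise_skew x y b d).
rewrite (D_pair (r x y a)) -(inner_raise c d (r x y a)) -/(q c d x y a b).
rewrite (D_pair a (r x y b)) -(inner_raise c d a).
rewrite -[g (r c d a) _]opprK -(raise_skew x y (r c d a) b) -/(q x y c d a b).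
rewrite -(inner_raise a b (r x y c)) -/(q a b x y c d).
rewrite -(inner_raise a b c) -[g (r a b c) _]opprK
  -(raise_skew x y (r a b c) d) -/(q x y a b c d).
ring.
Qed.

Lemma cyclic_projectiveP : (2 <= n)%N ->
  (forall x1 x2 x3 x4 x5 x6,
     RP x1 x2 x3 x4 x5 x6 + RP x3 x4 x5 x6 x1 x2 + RP x5 x6 x1 x2 x3 x4 = 0)
  <-> (forall a b c d, RS a b c d = 0).
Proof.
move=> n2; split=> [E0|RS0 *]; last by rewrite !RPE !RS0; ring.
have n2R : 2 <= n%:R :> R by rewrite ler_nat.
have k0 : (n%:R - 1)^-1 != 0 :> R by rewrite invr_neq0// gt_eqF; lra.
apply: (cyclic_eq0 G_sym G_unit) => //.
- by move=> a b c d; rewrite !RSE (ricci_sym a) (ricci_sym b) addrC.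
- move=> a b c d; rewrite !RSE ![r c d _]raise_alt (ricci_sym a).
  have SN u w : S (- u) w = - S u w.
    have S0 : S 0 w = 0.
      by have := ricci_lin (-1) 0 0 w; rewrite scaler0 addr0 mulN1r addNr.
    by rewrite -scaleN1r -[_ *: u]addr0 ricci_lin S0 addr0 mulN1r.
  by rewrite !SN (ricci_sym _ a) -opprD opprK.
- move=> k x y b c d; rewrite !RSE raise_lin3 !ricci_lin; ring.
- move=> k x y a b d; rewrite !RSE !raise_lin1 ricci_lin.
  by rewrite !(ricci_sym a) ricci_lin; ring.
(* The [q] terms cancel in the cyclic sum of [RP], which leaves [- (n - 1)^-1] times the required
   expression. *)
- move=> x1 x2 x3 x4 x5 x6; apply: (mulfI k0); rewrite mulr0.
  rewrite -[RHS]oppr0 -(E0 x1 x2 x3 x4 x5 x6) !RPE; ring.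
Qed.

End TensorDot.

(** * Symmetries of the Riemann tensor *)

Section MatrixFunctions.
Context {R : realType} {n : nat}.
Implicit Types U : set 'rV[R]_n.

Lemma Ck_prod k U (I : Type) (r : seq I) (P : pred I) (F : I -> 'rV[R]_n -> R) :
  open U -> (forall i, P i -> Ck k U (F i)) ->
  Ck k U (fun x => \prod_(i <- r | P i) F i x).
Proof.
move=> oU CF; elim: r => [|i r IH].
  by apply: eq_Ck (Ck_cst k 1 oU) => // x _; rewrite big_nil.
case Pi: (P i); last by apply: eq_Ck IH => // x _; rewrite big_cons Pi.
by apply: eq_Ck (CkM oU (CF i Pi) IH) => // x _; rewrite big_cons Pi.
Qed.

Lemma Ck_det k U m (A : 'rV[R]_n -> 'M[R]_m) :
  open U -> (forall a b, Ck k U (fun x => A x a b)) ->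
  Ck k U (fun x => \det (A x)).
Proof.
move=> oU CA; apply: Ck_sum => // s _; apply: CkM => //; first exact: Ck_cst.
exact: Ck_prod.
Qed.

(** By the adjugate formula the entries are cofactors over a nonvanishing determinant. This applies
    to the inverse metric inside [christoffel]. *)
Lemma differentiable_invmx k U m (A : 'rV[R]_n -> 'M[R]_m) a b x :
  open U -> (forall a b, Ck k U (fun x => A x a b)) ->
  (forall y, U y -> A y \in unitmx) -> U x ->
  differentiable (fun y => invmx (A y) a b) x.
Proof.
move=> oU CA uA Ux.
have E : \forall y \near x,
    (\det (A y))^-1 * cofactor (A y) b a = invmx (A y) a b.
  by apply: open_nearP Ux => // y /set_mem Uy; rewrite /invmx uA// !mxE.
apply: near_eq_differentiable E _.
apply: differentiableM.
  apply: differentiableV; first exact: Ck_differentiable (Ck_det oU CA) Ux.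
  by rewrite -unitfE; exact: uA.
apply: (@Ck_differentiable _ _ k U) => //.
rewrite /cofactor; apply: CkM => //; first exact: Ck_cst.
by apply: Ck_det => // c d; apply: eq_Ck (CA (lift b c) (lift a d))
  => // y _; rewrite !mxE.
Qed.

End MatrixFunctions.

(** * The curvature tensor in coordinates *)

Section CurvatureSymmetries.
Context {R : realType} {n : nat} {M : manifold R n}.
Variables (g : semi_riemannian_metric M) (i : chart M).
Implicit Types (a b c d l m : 'I_n) (x : 'rV[R]_n).

Let U : set 'rV[R]_n := phi i @` dom i.
Let gam c d x : R := g i (psi i x) c d.
Local Notation Gam := (christoffel g i).

Let oU : open U. Proof. exact: phi_open. Qed.

Let psiU x : U x -> dom i (psi i x).
Proof. by move=> [q qi <-]; rewrite phiK. Qed.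

Let gam_Ck k c d : Ck k U (gam c d).
Proof. by have /smooth_onP := @gram_smooth _ _ _ g i c d; apply. Qed.

Let dgam_Ck k a c d : Ck k U (partial a (gam c d)).
Proof. exact: (gam_Ck k.+1 c d).2. Qed.

Let gam_sym x c d : U x -> gam c d x = gam d c x.
Proof. by move=> /psiU /(gram_sym g) E; rewrite /gam -{1}E mxE. Qed.

Let dgam_sym x a c d : U x -> partial a (gam c d) x = partial a (gam d c) x.
Proof.
move=> Ux; apply: near_eq_derive; apply: open_nearP Ux => // y /set_mem Uy.
exact: gam_sym.
Qed.

Let h a b c d x := partial a (partial b (gam c d)) x.

Let h_sym34 x a b c d : U x -> h a b c d x = h a b d c x.
Proof.
move=> Ux; apply: near_eq_derive; apply: open_nearP Ux => // y /set_mem Uy.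
exact: dgam_sym.
Qed.

Let h_sym12 x a b c d : U x -> h a b c d x = h b a c d x.
Proof. exact: Ck_schwarz. Qed.

(** Christoffel symbols of the first kind. *)
Let low m a b x : R :=
  2^-1 * (partial a (gam m b) x + partial b (gam m a) x
          - partial m (gam a b) x).

Let lowS x m a b : U x -> low m a b x = low m b a x.
Proof. by move=> Ux; rewrite /low (dgam_sym m a b Ux) [X in X - _]addrC. Qed.

Let GamE l a b x : Gam l a b x = \sum_m invmx (g i (psi i x)) l m * low m a b x.
Proof.
by rewrite /christoffel mulr_sumr; apply: eq_bigr => m _; rewrite mulrCA.
Qed.

Let gam_Gam x d a b : U x -> \sum_l gam l d x * Gam l a b x = low d a b x.
Proof.
move=> Ux; have ug := gram_nondegenerate g (psiU Ux).
transitivity (((g i (psi i x)) *m (invmx (g i (psi i x)) *m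
  \col_m low m a b x)) d 0); last by rewrite mulKVmx// mxE.
rewrite mxE; apply: eq_bigr => l _; rewrite -/(gam d l x) gam_sym// GamE mxE.
by congr (_ * _); apply: eq_bigr => m _; rewrite !mxE.
Qed.

(** This is metric compatibility, [nabla g = 0], in coordinates. *)
Let dgamE x a d l : U x -> partial a (gam d l) x = low d a l x + low l a d x.
Proof.
move=> Ux; rewrite /low (dgam_sym a l d Ux) (dgam_sym l a d Ux).
by rewrite (dgam_sym d l a Ux); field.
Qed.

Let low_Ck k m a b : Ck k U (low m a b).
Proof.
rewrite /cofactor; apply: CkM => //; first exact: Ck_cst.
apply: CkD => //; first exact: CkD.
apply: eq_Ck (CkM oU (Ck_cst k (-1) oU) (dgam_Ck k m a b)) => // x _.
by rewrite mulN1r.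
Qed.

Let Gam_differentiable x l a b : U x -> differentiable (Gam l a b) x.
Proof.
move=> Ux.
have -> : Gam l a b = \sum_m (fun y => invmx (g i (psi i y)) l m * low m a b y).
  by apply/funext => y; rewrite GamE fct_sumE.
apply: differentiable_sum => m; apply: differentiableM.
  apply: (@differentiable_invmx _ _ 0 U) => //; first exact: (gam_Ck 0).
  by move=> y /psiU; exact: gram_nondegenerate.
exact: Ck_differentiable (low_Ck 0 m a b) Ux.
Qed.

(** Differentiating [gam_Gam] by the product rule moves the derivative from [Gam] to [low], so the
    derivative of the inverse metric is never computed. *)
Let gam_dGam x a b c d : U x ->
  \sum_l gam l d x * partial a (Gam l b c) x =
  partial a (low d b c) x - \sum_l Gam l b c x * (low d a l x + low l a d x).
Proof.
move=> Ux; apply/eqP; rewrite eq_sym subr_eq -big_split/=; apply/eqP.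
transitivity (partial a (\sum_l (fun y => gam l d y * Gam l b c y)) x).
  apply: near_eq_derive; apply: open_nearP Ux => // y /set_mem Uy.
  by rewrite fct_sumE gam_Gam.
have dg l : derivable (gam l d) x 'e_a.
  by apply: diff_derivable; exact: Ck_differentiable (gam_Ck 0 l d) Ux.
have dG l : derivable (Gam l b c) x 'e_a.
  by apply: diff_derivable; exact: Gam_differentiable.
rewrite /partial derive_sum; last by move=> l; exact: derivableM.
apply: eq_bigr => l _; rewrite deriveM//; congr (_ + _ * _).
by rewrite -/(partial a (gam l d) x) dgamE// addrC.
Qed.

Let dlow x a d b c : U x ->
  partial a (low d b c) x = 2^-1 * (h a b d c x + h a c d b x - h a d b c x).
Proof.
move=> Ux; have D a' c' d' : derivable (partial a' (gam c' d')) x 'e_a.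
  by apply: diff_derivable; exact: Ck_differentiable (dgam_Ck 0 a' c' d') Ux.
rewrite /partial /low.
rewrite (@deriveMl _ _ (partial b (gam d c) + partial c (gam d b) -
   partial d (gam b c))); last by apply: derivableB => //; exact: derivableD.
rewrite deriveB//; last exact: derivableD.
by rewrite deriveD.
Qed.

(** In invariant terms, [g(nabla_a e_b, nabla_c e_d)]. *)
Let B a b c d x := \sum_l Gam l a b x * low l c d x.

Let B_swap x a b c d : U x -> B a b c d x = B c d a b x.
Proof.
move=> Ux; have sg := gram_sym g (psiU Ux).
rewrite /B; under eq_bigr do rewrite GamE mulr_suml.
rewrite exchange_big; apply: eq_bigr => m _ /=.
rewrite GamE mulr_suml; apply: eq_bigr => l _.
by rewrite -{1}sg -trmx_inv mxE; ring.
Qed.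

Let B_sym34 x a b c d : U x -> B a b c d x = B a b d c x.
Proof. by move=> Ux; apply: eq_bigr => l _; rewrite lowS. Qed.

Let B_sym12 x a b c d : U x -> B a b c d x = B b a c d x.
Proof. by move=> Ux; rewrite B_swap// B_sym34// B_swap. Qed.

Let gam_dGamE x a b c d : U x ->
  \sum_l gam l d x * partial a (Gam l b c) x =
  2^-1 * (h a b d c x + h a c d b x - h a d b c x) -
  (\sum_m low d a m x * Gam m b c x + B b c a d x).
Proof.
move=> Ux; apply: etrans (gam_dGam a b c d Ux) _.
congr (_ - _); first exact: dlow.
rewrite -big_split; apply: eq_bigr => l _ /=; rewrite mulrDr.
by congr (_ + _); exact: mulrC.
Qed.

Definition riemann_low a b c d x :=
  \sum_l riemann_comp g i l a b c x * g i (psi i x) l d.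

(** The classical expression of [R_abcd] by second derivatives of [g] and products of Christoffel
    symbols, from which the index symmetries can be read off. *)
Let riemann_lowE x a b c d : U x -> riemann_low a b c d x =
  2^-1 * (h a c d b x - h a d b c x - h b c d a x + h b d a c x)
  - B b c a d x + B a c b d x.
Proof.
move=> Ux.
transitivity (\sum_l gam l d x * partial a (Gam l b c) x
  - \sum_l gam l d x * partial b (Gam l a c) x
  + (\sum_m (low d a m x * Gam m b c x) - \sum_m (low d b m x * Gam m a c x))).
  rewrite /riemann_low; under eq_bigr => l _ do
    rewrite mulrC -/(gam l d x) /riemann_comp mulrDr mulrBr mulr_sumr.
  rewrite big_split/= sumrB; congr (_ + _).
  rewrite exchange_big -sumrB; apply: eq_bigr => m _ /=.
  rewrite -(gam_Gam d a m Ux) -(gam_Gam d b m Ux) !mulr_suml -sumrB.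
  by apply: eq_bigr => l _; rewrite mulrBr !mulrA.
(* [T1] and [T2], the Christoffel products in the curvature, cancel against the same sums in
   [gam_dGamE]; [v1] and [v2] are the surviving [B] terms. *)
have cancel_T (S1 S2 T1 T2 u1 u2 v1 v2 : R) :
    S1 = u1 - (T1 + v1) -> S2 = u2 - (T2 + v2) ->
    S1 - S2 + (T1 - T2) = u1 - u2 - v1 + v2.
  by move=> -> ->; ring.
apply: etrans (cancel_T _ _ _ _ _ _ _ _ (gam_dGamE a b c d Ux)
  (gam_dGamE b a c d Ux)) _.
rewrite (h_sym12 b a d c Ux).
move: (h _ _ _ _ x) (h _ _ _ _ x) (h _ _ _ _ x) (h _ _ _ _ x) (h _ _ _ _ x).
by move: (B _ _ _ _ x) (B _ _ _ _ x) => *; ring.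
Qed.

(** Exchanging [c] and [d] permutes the [h] terms with a change of sign, by symmetry of [g], and
    interchanges the two [B] terms up to [B_swap]. *)
Lemma riemann_low_alt x a b c d : U x ->
  riemann_low a b c d x = - riemann_low a b d c x.
Proof.
move=> Ux; rewrite !riemann_lowE//.
rewrite (h_sym34 a d c b Ux) (h_sym34 a c b d Ux) (h_sym34 b d c a Ux).
rewrite (h_sym34 b c a d Ux) (B_swap b d a c Ux) (B_swap a d b c Ux).
move: (h _ _ _ _ x) (h _ _ _ _ x) (h _ _ _ _ x) (h _ _ _ _ x).
by move: (B _ _ _ _ x) (B _ _ _ _ x) => *; ring.
Qed.

(** Exchanging the pairs interchanges the two middle [h] terms and fixes the outer ones, by
    Schwarz's theorem and symmetry of [g]; each [B] term is fixed. *)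
Lemma riemann_low_pair x a b c d : U x ->
  riemann_low a b c d x = riemann_low c d a b x.
Proof.
move=> Ux; rewrite !riemann_lowE//.
rewrite (h_sym12 c a b d Ux) (h_sym34 a c b d Ux) (h_sym12 c b d a Ux).
rewrite (h_sym12 d a b c Ux) (h_sym12 d b c a Ux) (h_sym34 b d c a Ux).
rewrite (B_swap d a c b Ux) (B_sym12 c b d a Ux) (B_sym34 b c d a Ux).
rewrite (B_sym12 c a d b Ux) (B_sym34 a c d b Ux).
move: (h _ _ _ _ x) (h _ _ _ _ x) (h _ _ _ _ x) (h _ _ _ _ x).
by move: (B _ _ _ _ x) (B _ _ _ _ x) => *; ring.
Qed.

Variable p : M.
Hypothesis ip : dom i p.
Local Notation Rm := (riemann g i p).

(** Expansion in components carries the symmetries of [riemann_low] over to arbitrary vectors. *)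
Lemma riemannE (x y z w : 'rV[R]_n) : Rm [tuple x; y; z; w] =
  \sum_a \sum_b \sum_c \sum_d
    x 0 a * y 0 b * z 0 c * w 0 d * riemann_low a b c d (phi i p).
Proof.
apply: eq_bigr => a _; apply: eq_bigr => b _; apply: eq_bigr => c _ /=.
rewrite /inner mxE mulr_sumr; apply: eq_bigr => d _.
rewrite -!mulrA; do 3 congr (_ * _).
rewrite mulrC !mxE; congr (_ * _); apply: eq_bigr => l _.
by rewrite mxE phiK.
Qed.

Let Up : U (phi i p). Proof. by exists p. Qed.

Lemma riemann_linear k (x x' y z w : 'rV[R]_n) :
  Rm [tuple k *: x + x'; y; z; w] =
  k * Rm [tuple x; y; z; w] + Rm [tuple x'; y; z; w].
Proof.
rewrite !riemannE mulr_sumr -big_split; apply: eq_bigr => a _ /=.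
rewrite mulr_sumr -big_split; apply: eq_bigr => b _ /=.
rewrite mulr_sumr -big_split; apply: eq_bigr => c _ /=.
rewrite mulr_sumr -big_split; apply: eq_bigr => d _ /=.
rewrite !mxE; ring.
Qed.

Lemma riemann_alt (x y z w : 'rV[R]_n) :
  Rm [tuple x; y; z; w] = - Rm [tuple x; y; w; z].
Proof.
rewrite !riemannE -sumrN; apply: eq_bigr => a _.
rewrite -sumrN; apply: eq_bigr => b _; rewrite exchange_big -sumrN.
apply: eq_bigr => d _; rewrite -sumrN; apply: eq_bigr => c _.
by rewrite riemann_low_alt//; ring.
Qed.

Lemma riemann_pair (x y z w : 'rV[R]_n) :
  Rm [tuple x; y; z; w] = Rm [tuple z; w; x; y].
Proof.
(* Summing over the pairs [(a, b)] and [(c, d)] turns the pair exchange into a single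
   [exchange_big]. *)
rewrite !riemannE pair_big [RHS]pair_big/=.
under eq_bigr do rewrite pair_big/=.
under [RHS]eq_bigr do rewrite pair_big/=.
rewrite exchange_big; apply: eq_bigr => -[c d] _; apply: eq_bigr => -[a b] _.
by rewrite riemann_low_pair//=; ring.
Qed.

End CurvatureSymmetries.

Theorem theorem4p1 (R : realType) (n : nat) (hn : (3 <= n)%N)
    (M : manifold R n) (hM : connected [set: M])
    (g : semi_riemannian_metric M) :
  (forall (X1 X2 X3 X4 X5 X6 : vector_field M) (i : chart M) (p : M),
     dom i p ->
     R_dot_P g i p X1 X2 X3 X4 X5 X6 +
     R_dot_P g i p X3 X4 X5 X6 X1 X2 +
     R_dot_P g i p X5 X6 X1 X2 X3 X4 = 0)
  <-> ricci_semisymmetric g.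
Proof.
(* At a fixed point the equivalence is pure algebra for arbitrary vectors. It remains to realize
   these vectors as values of vector fields. *)
have pointwise i p (ip : dom i p) := cyclic_projectiveP (gram_sym g ip)
  (gram_nondegenerate g ip) (riemann_linear g ip) (riemann_alt g ip)
  (riemann_pair g ip) (ltnW hn).
split=> [cyc0 X1 X2 X Y i p ip|RS0 X1 X2 X3 X4 X5 X6 i p ip].
  apply: (pointwise i p ip).1 => x1 x2 x3 x4 x5 x6.
  have [[X1' <-] [X2' <-]] :=
    (vector_field_extension x1 ip, vector_field_extension x2 ip).
  have [[X3' <-] [X4' <-]] :=
    (vector_field_extension x3 ip, vector_field_extension x4 ip).
  have [[X5' <-] [X6' <-]] :=
    (vector_field_extension x5 ip, vector_field_extension x6 ip).
  exact: cyc0.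
apply: (pointwise i p ip).2 => a b c d.
have [[X1' <-] [X2' <-]] :=
  (vector_field_extension a ip, vector_field_extension b ip).
have [[X3' <-] [X4' <-]] :=
  (vector_field_extension c ip, vector_field_extension d ip).
exact: RS0.
Qed.
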